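(* Let $p,q\in\mathbb N$ with $p>q\ge 1$, let $\varphi$ be the morphism on $\{A,B\}^*$ given by $\varphi(A)=A^pB$, $\varphi(B)=A^qB$, and let ${\bf u}_\beta=\lim_{m\to\infty}\varphi^m(A)$ be its fixed point. Let $U_m=|\varphi^m(A)|$ for $m\ge 0$, and let $w^{(0)}=B$, $w^{(m)}=B\varphi(w^{(m-1)})$ for $m\ge 1$. Then for all $n\in\mathbb N$ the Abelian complexity of ${\bf u}_\beta$ satisfies $$\mathcal{AC}(n)=1+U_k-\sum_{j=1}^{k}(d_j+e_j)U_{j-1},$$ where $k\in\mathbb N_0$ is arbitrary such that $n\le |w^{(k)}|$, and the $d_j$, $e_j$ are the digits of the normal $U$-representations $\langle n\rangle_U=(d_k,d_{k-1},\ldots,d_1,d_0)$ and $\langle U_{k+1}-n\rangle_U=(e_k,e_{k-1},\ldots,e_1,e_0)$.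
   Context: $\mathbb N$ is the set of positive integers and $\mathbb N_0=\mathbb N\cup\{0\}$. For a finite word $w$ over $\{A,B\}$, $|w|$ is its length and $|w|_A,|w|_B$ are the numbers of occurrences of $A$, $B$ in $w$. A factor of an infinite word is a finite block of consecutive letters of it. The Abelian complexity of an infinite word ${\bf u}$ over $\{A,B\}$ is $\mathcal{AC}(n)=\#\{(|w|_A,|w|_B) : w \text{ a factor of } {\bf u} \text{ of length } n\}$. The infinite word ${\bf u}_\beta=\lim_{m\to\infty}\varphi^m(A)$ is the infinite word having every $\varphi^m(A)$ as a prefix; it is the unique fixed point of $\varphi$ (the action of $\varphi$ being extended to infinite words by concatenation). Normal $U$-representation: given the strictly increasing sequence $U=(U_m)_{m\ge0}$ with $U_0=1$ and an integer $n\ge 0$, choose any $N\in\mathbb N_0$ with $n<U_{N+1}$, put $x_N:=n$, and for $j=N,N-1,\ldots,0$ put $d_j:=\lfloor x_j/U_j\rfloor$ and $x_{j-1}:=x_j-d_jU_j$. Then $\langle n\rangle_U=(d_N,\ldots,d_0)$; leading zeros are permitted (any admissible $N$ may be used), and $n=\sum_{j=0}^N d_jU_j$. *)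

(* Defs.v *)
From HB Require Import structures.
From mathcomp Require Import all_boot all_order all_algebra.
From mathcomp Require Import finmap.
From mathcomp Require Import boolp classical_sets functions cardinality.
From mathcomp Require Import zify.
Set Implicit Arguments.
Unset Strict Implicit.
Unset Printing Implicit Defensive.

Variant letter := A | B.

Definition letter_eqb (x y : letter) : bool :=
  match x, y with A, A | B, B => true | _, _ => false end.

Lemma letter_eqP : Equality.axiom letter_eqb.
Proof. by case; case; constructor. Qed.

HB.instance Definition _ := hasDecEq.Build letter letter_eqP.

Definition word := seq letter.

Definition infinite_word := nat -> letter.

Definition parikh (w : word) : nat * nat := (count_mem A w, count_mem B w).

Definition block (u : infinite_word) (i n : nat) : word :=
  mkseq (fun j => u (i + j)) n.

Definition factors (u : infinite_word) (n : nat) : set word :=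
  [set w | exists i, w = block u i n]%classic.

(* [fset_set] is only meaningful on finite sets: see [finite_parikh_factors]. *)
Definition abelian_complexity (u : infinite_word) (n : nat) : nat :=
  #|` fset_set [set parikh w | w in factors u n]%classic|%fset.

Definition phi_letter (p q : nat) (x : letter) : word :=
  match x with A => rcons (nseq p A) B | B => rcons (nseq q A) B end.

Definition phi (p q : nat) (w : word) : word := flatten (map (phi_letter p q) w).

Definition phi_iter (p q m : nat) (w : word) : word := iter m (phi p q) w.

(* The limit of the words phi^m(A): position i is read in phi^i(A), which has
   more than i letters. See [u_beta_prefix] and [u_beta_unique]. *)
Definition u_beta (p q : nat) : infinite_word :=
  fun i => nth A (phi_iter p q i [:: A]) i.

Definition U (p q m : nat) : nat := size (phi_iter p q m [:: A]).

Fixpoint w_seq (p q m : nat) : word :=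
  if m is m'.+1 then B :: phi p q (w_seq p q m') else [:: B].

(* Digit of index j of the normal V-representation of n with N + 1 digits,
   i.e. the greedy algorithm started at x_N := n. It is a representation of n
   only if n < V N.+1; digits of index j > N are set to 0. *)
Fixpoint udigit (V : nat -> nat) (N n j : nat) : nat :=
  let d := n %/ V N in
  if j == N then d
  else if N is N'.+1 then udigit V N' (n - d * V N) j else 0.

Lemma finite_parikh_factors (u : infinite_word) (n : nat) :
  finite_set [set parikh w | w in factors u n]%classic.
Proof.
apply: (@sub_finite_set _ _ (`I_n.+1 `*` `I_n.+1)%classic); last first.
  by apply: finite_setX; apply: finite_II.
move=> _ [w [i ->]] <-; rewrite /parikh /block.
set s := mkseq _ _; have sz : size s = n by rewrite size_mkseq.
by split; rewrite /= ltnS -sz count_size.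
Qed.

Lemma phi_iterS p q m w : phi_iter p q m.+1 w = phi p q (phi_iter p q m w).
Proof. by []. Qed.

Lemma phi_cat p q s t : phi p q (s ++ t) = phi p q s ++ phi p q t.
Proof. by rewrite /phi map_cat flatten_cat. Qed.

Lemma count_phi p q w :
  (count_mem A (phi p q w) = p * count_mem A w + q * count_mem B w) *
  (count_mem B (phi p q w) = count_mem A w + count_mem B w).
Proof.
elim: w => [|x w [IHA IHB]]; first by rewrite /= !muln0.
rewrite /phi /= -/(phi p q w) !count_cat {}IHA {}IHB.
by case: x; rewrite /= -cats1 !count_cat !count_nseq /=; split; lia.
Qed.

Lemma size_count_letter (w : word) : size w = count_mem A w + count_mem B w.
Proof. by elim: w => //= -[] w ->; rewrite /= ?addSn ?addnS. Qed.

Lemma phi_iter_prefix p q m n : 0 < p -> m <= n ->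
  prefix (phi_iter p q m [:: A]) (phi_iter p q n [:: A]).
Proof.
case: p => // p _; elim: n => [|n IHn]; first by rewrite leqn0 => /eqP->.
rewrite leq_eqVlt ltnS => /orP[/eqP->|/IHn/prefix_trans]; first exact: prefix_refl.
apply; elim: n {IHn} => [|n IHn]; first by rewrite /phi_iter /phi /= ?prefix0s.
by rewrite 2!phi_iterS; case/prefixP: IHn => t ->; rewrite phi_cat prefix_prefix.
Qed.

Lemma phi_iter_count p q m : 0 < p ->
  (0 < count_mem A (phi_iter p q m [:: A])) && (m < U p q m).
Proof.
move=> p0; rewrite /U; elim: m => // m /andP[IHA IHm].
rewrite phi_iterS size_count_letter !count_phi -size_count_letter.
by apply/andP; split; nia.
Qed.

Lemma u_beta_prefix p q m : 0 < p ->
  block (u_beta p q) 0 (U p q m) = phi_iter p q m [:: A].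
Proof.
move=> p0; apply: (@eq_from_nth _ A); rewrite size_mkseq // => i im.
rewrite nth_mkseq // add0n /u_beta.
have /andP[_ ii] := phi_iter_count q i p0.
have [le_im|/ltnW le_mi] := leqP i m.
  by have /prefixP[t ->] := phi_iter_prefix q p0 le_im; rewrite nth_cat ii.
by have /prefixP[t ->] := phi_iter_prefix q p0 le_mi; rewrite nth_cat im.
Qed.

Lemma u_beta_unique p q (u : infinite_word) : 0 < p ->
  (forall m, block u 0 (U p q m) = phi_iter p q m [:: A]) -> u = u_beta p q.
Proof.
move=> p0 uP; apply/funext => i; have /andP[_ ii] := phi_iter_count q i p0.
by rewrite /u_beta -uP nth_mkseq.
Qed.

(* For 1 <= n <= |w^(k)|, both n and U_{k+1} - n are nonnegative and
   less than U_{k+1}: the truncated subtraction is exact, and both numbers have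
   normal U-representations with k + 1 digits. *)
Lemma w_seq_lt_U p q k : 0 < p -> size (w_seq p q k) < U p q k.+1.
Proof.
move=> p0.
rewrite /U !size_count_letter.
suff /andP[hA hB] :
    (count_mem A (w_seq p q k) < count_mem A (phi_iter p q k.+1 [:: A])) &&
    (count_mem B (w_seq p q k) <= count_mem B (phi_iter p q k.+1 [:: A])).
  by rewrite -addSn leq_add.
elim: k => [|k]; first by rewrite phi_iterS !count_phi /= muln0 muln1 !addn0 p0.
rewrite (phi_iterS p q k.+1) -[w_seq p q k.+1]/([:: B] ++ phi p q (w_seq p q k)).
rewrite !count_cat !count_phi.
move=> /andP[hA hB]; apply/andP; split.
  by rewrite add0n -addSn leq_add ?ltn_pmul2l // leq_mul2l hB orbT.
by rewrite (_ : count_mem B [:: B] = 1) // addnA add1n leq_add.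
Qed.

(* Main.v *)
(** Let [c i] be the number of B's among the first [i] letters of the fixed
    point and [L m] the length of the image of its prefix of length [m].
    Since each phi(x) has a single B, its last letter, [c] and [L] form a Galois
    connection, [m <= c i <-> L m <= i], while [L m = (p+1) m - (p-q) c m].
    Feeding each relation into the other shows that [c] is superadditive, so
    prefixes have the fewest B's among factors of the same length; that short
    suffixes of phi^(k+1)(A) have the most; and that [c] is additive along
    normal U-representations.  Every intermediate number of B's occurs, as
    it changes by at most one when the window slides by one letter. *)
Require Import Defs.
From mathcomp Require Import all_boot all_order all_algebra.
From mathcomp Require Import finmap classical_sets cardinality zify.
Set Implicit Arguments.
Unset Strict Implicit.
Unset Printing Implicit Defensive.
Import GRing.Theory.
Local Open Scope ring_scope.

(** * Prefix counts and image lengths *)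

Definition prefix_B (p q i : nat) : nat := count_mem B (block (u_beta p q) 0 i).

Definition image_len (p q m : nat) : nat :=
  size (phi p q (block (u_beta p q) 0 m)).

Lemma block_cat u i m n : block u i (m + n) = block u i m ++ block u (i + m) n.
Proof.
rewrite /block /mkseq iotaD map_cat add0n -{2}[m]addn0 iotaDl -map_comp.
by congr (_ ++ _); apply: eq_map => j /=; rewrite addnA.
Qed.

Lemma block_rcons u i n : block u i n.+1 = rcons (block u i n) (u (i + n)%N).
Proof. by rewrite -addn1 block_cat -cats1 /block /mkseq /= addn0. Qed.

Lemma count_B_block p q i n :
  (prefix_B p q i + count_mem B (block (u_beta p q) i n))%N = prefix_B p q (i + n).
Proof. by rewrite /prefix_B block_cat count_cat. Qed.

Lemma prefix_B0 p q : prefix_B p q 0 = 0%N.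
Proof. by []. Qed.

Lemma prefix_BS p q i :
  prefix_B p q i.+1 = (prefix_B p q i + (u_beta p q i == B))%N.
Proof. by rewrite /prefix_B block_rcons -cats1 count_cat /= addn0. Qed.

Lemma leq_prefix_B p q i j :
  (i <= j)%N -> (prefix_B p q i <= prefix_B p q j)%N.
Proof. by move=> /subnKC<-; rewrite -count_B_block leq_addr. Qed.

Lemma prefix_B_le p q i : (prefix_B p q i <= i)%N.
Proof.
rewrite /prefix_B -[leqRHS](size_mkseq (fun j => u_beta p q (0 + j)) i).
exact: count_size.
Qed.

Lemma image_lenE p q m :
  image_len p q m =
    (m + p * (m - prefix_B p q m) + q * prefix_B p q m)%N.
Proof.
rewrite /image_len /prefix_B size_count_letter !count_phi.
have := size_count_letter (block (u_beta p q) 0 m).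
rewrite size_mkseq; nia.
Qed.

Lemma image_len_compl p q m : (q <= p)%N ->
  (image_len p q m + (p - q) * prefix_B p q m = p.+1 * m)%N.
Proof.
move=> qp; rewrite image_lenE; have := prefix_B_le p q m; nia.
Qed.

(** As [m < U m], the prefix of length [m] lies inside phi^m(A), so both sides are prefixes of
    phi^(m+1)(A). *)
Lemma block_image_len p q m : (0 < p)%N ->
  block (u_beta p q) 0 (image_len p q m) = phi p q (block (u_beta p q) 0 m).
Proof.
move=> p0; have /andP[_ lt_mU] := phi_iter_count q m p0.
have := u_beta_prefix q m.+1 p0; rewrite phi_iterS -(u_beta_prefix q m p0).
rewrite -[in X in _ = X](subnKC (ltnW lt_mU)) block_cat phi_cat => eqU.
have szU : U p q m.+1 = size (block (u_beta p q) 0 (U p q m.+1)).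
  by rewrite size_mkseq.
have le_LU : (image_len p q m <= U p q m.+1)%N.
  by rewrite szU eqU size_cat leq_addr.
move: eqU; rewrite -[X in block _ _ X](subnKC le_LU) block_cat.
by move=> /eqP; rewrite eqseq_cat ?size_mkseq // => /andP[/eqP].
Qed.

Lemma prefix_B_image_len p q m : (0 < p)%N -> prefix_B p q (image_len p q m) = m.
Proof.
move=> p0; rewrite /prefix_B block_image_len // count_phi.
by rewrite -size_count_letter size_mkseq.
Qed.

(** The letter dropped is the B that ends the image of the last letter. *)
Lemma prefix_B_image_len_pred p q m i : (0 < p)%N ->
  image_len p q m.+1 = i.+1 -> prefix_B p q i = m.
Proof.
move=> p0 Li; have := block_image_len q m.+1 p0; rewrite Li block_rcons.
rewrite block_rcons -(cats1 (block _ _ m)) phi_cat /phi /= cats0 add0n => eq_rcons.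
have [w eqw] : exists w, phi_letter p q (u_beta p q m) = rcons w B.
  by case: (u_beta p q m); [exists (nseq p A) | exists (nseq q A)].
move: eq_rcons; rewrite eqw -rcons_cat => /rcons_inj[_ uB].
have := prefix_B_image_len q m.+1 p0; rewrite Li prefix_BS uB eqxx; lia.
Qed.

Lemma prefix_B_galois p q m i : (0 < p)%N ->
  (m <= prefix_B p q i)%N = (image_len p q m <= i)%N.
Proof.
move=> p0; apply/idP/idP; last first.
  by move=> /(leq_prefix_B p q); rewrite prefix_B_image_len.
apply: contraTT; rewrite -!ltnNge; case: m => [|m].
  by rewrite image_lenE prefix_B0 !muln0.
case E: (image_len p q m.+1) => [|j] //; rewrite !ltnS.
by move=> /(leq_prefix_B p q); rewrite (prefix_B_image_len_pred _ E).
Qed.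

Lemma ltn_image_len p q m n : (0 < p)%N ->
  (m < n)%N -> (image_len p q m < image_len p q n)%N.
Proof.
move=> p0; apply: contraTT.
by rewrite -!leqNgt -prefix_B_galois // prefix_B_image_len.
Qed.

(** * Superadditivity, and additivity along U *)

Lemma U_image_len p q k : (0 < p)%N -> U p q k.+1 = image_len p q (U p q k).
Proof. by move=> p0; rewrite /image_len u_beta_prefix. Qed.

Lemma prefix_B_US p q k : (0 < p)%N -> prefix_B p q (U p q k.+1) = U p q k.
Proof. by move=> p0; rewrite U_image_len // prefix_B_image_len. Qed.

Lemma prefix_B_lt_U p q k i : (0 < p)%N ->
  (prefix_B p q i < U p q k)%N = (i < U p q k.+1)%N.
Proof. by move=> p0; rewrite U_image_len // !ltnNge prefix_B_galois. Qed.

Lemma prefix_B_small p q i : (0 < p)%N -> (i <= p)%N -> prefix_B p q i = 0%N.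
Proof.
move=> p0 ip; apply/eqP; rewrite -leqn0 leqNgt prefix_B_galois //.
have : (prefix_B p q 1 < U p q 0)%N.
  rewrite prefix_B_lt_U // /U /phi_iter /phi /=.
  by rewrite size_cat size_rcons size_nseq; lia.
rewrite image_lenE /U /=; nia.
Qed.

Lemma prefix_B_lt p q i : (0 < p)%N -> (0 < i)%N -> (prefix_B p q i < i)%N.
Proof.
move=> p0; case: i => // i _.
rewrite -{1}[i.+1]add1n -count_B_block prefix_B_small // add0n.
by rewrite ltnS -[leqRHS](size_mkseq (fun j => u_beta p q (1 + j)) i) count_size.
Qed.

(** Strong induction on [i + n]. With [a], [b] the two counts, the claim is [L (a + b) <= i + n].
    Superadditivity of [c] at [a], [b] gives [L (a + b) <= L a + L b], and [L a <= i],
    [L b <= n]. *)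
Lemma prefix_B_superadd p q i n : (q < p)%N ->
  (prefix_B p q i + prefix_B p q n <= prefix_B p q (i + n))%N.
Proof.
move=> qp; have p0 : (0 < p)%N by lia.
have [s le_s] := ubnP (i + n)%N; elim: s i n le_s => // s IHs i n le_s.
case: n le_s => [|n] le_s; first by rewrite prefix_B0 !addn0.
rewrite prefix_B_galois //.
have ltn := prefix_B_lt q p0 (ltn0Sn n); have lei := prefix_B_le p q i.
have Li : (image_len p q (prefix_B p q i) <= i)%N by rewrite -prefix_B_galois.
have Ln : (image_len p q (prefix_B p q n.+1) <= n.+1)%N
  by rewrite -prefix_B_galois.
move: (prefix_B p q i) (prefix_B p q n.+1) Li Ln lei ltn => a b Li Ln lei ltn.
have cab : (a + b < s)%N by lia.
have := leq_mul (leqnn (p - q)) (IHs a b cab); rewrite mulnDr.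
have := image_len_compl a (ltnW qp); have := image_len_compl b (ltnW qp).
have := image_len_compl (a + b) (ltnW qp).
rewrite mulnDr; lia.
Qed.

(* Additivity fails at [d * U k + r = U k.+1]: the last letter of phi^k(B)
   is not that of the prefix of the same length. *)
Lemma prefix_B_add_U p q k d r : (q < p)%N ->
  (r < U p q k)%N -> (d * U p q k + r < U p q k.+1)%N ->
  prefix_B p q (d * U p q k + r) = (d * prefix_B p q (U p q k) + prefix_B p q r)%N.
Proof.
move=> qp; have p0 : (0 < p)%N by lia.
elim: k d r => [|k IHk] d r r_lt dr_lt.
  have U0 : U p q 0 = 1%N by [].
  move: r_lt dr_lt; rewrite -prefix_B_lt_U // U0 !ltnS !leqn0 => /eqP-> /eqP->.
  by rewrite prefix_B_small ?muln0.
rewrite prefix_B_US //; set a := prefix_B p q r.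
have a_lt : (a < U p q k)%N by rewrite prefix_B_lt_U.
have le_cd e : (e * U p q k <= prefix_B p q (e * U p q k.+1))%N.
  elim: e => // e IHe; rewrite !mulSn.
  have := prefix_B_superadd (U p q k.+1) (e * U p q k.+1) qp.
  by rewrite prefix_B_US //; lia.
have le_m : (d * U p q k + a <= prefix_B p q (d * U p q k.+1 + r))%N.
  by have := prefix_B_superadd (d * U p q k.+1) r qp; have := le_cd d; lia.
(* The upper bound becomes [d * U k.+1 + r < L (d * U k + a).+1]. *)
apply/eqP; rewrite eqn_leq le_m andbT -ltnS ltnNge prefix_B_galois // -ltnNge.
have lt_U : (prefix_B p q (d * U p q k.+1 + r) < U p q k.+1)%N by rewrite prefix_B_lt_U.
(* If [(d * U k + a).+1] is [U k.+1], the induction hypothesis does not reach it, but its image has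
   length [U k.+2]. *)
have := lt_U => /(leq_ltn_trans le_m); rewrite leq_eqVlt => /orP[/eqP->|m_lt].
  by rewrite -U_image_len.
have La : (r < image_len p q a.+1)%N by rewrite ltnNge -prefix_B_galois // ltnn.
suff -> : image_len p q (d * U p q k + a).+1 = (d * U p q k.+1 + image_len p q a.+1)%N.
  by lia.
have cE : prefix_B p q (d * U p q k + a).+1 =
    (d * prefix_B p q (U p q k) + prefix_B p q a.+1)%N.
  have [a_U|a_U] := ltnP a.+1 (U p q k); first by rewrite -addnS IHk // addnS.
  (* [U k] is no valid remainder: carry it into the multiplier [d.+1], with remainder 0. *)
  have aU : a.+1 = U p q k by lia.
  rewrite -addnS aU -mulSnr -[in LHS](addn0 (_ * _)%N) IHk ?prefix_B0; try lia.
have := image_len_compl (d * U p q k + a).+1 (ltnW qp).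
have := image_len_compl a.+1 (ltnW qp).
have := congr1 (muln d) (image_len_compl (U p q k) (ltnW qp)).
rewrite cE U_image_len // -addnS !mulnDr ![(d * (_ * _))%N]mulnCA; lia.
Qed.

(** Additivity peels off the leading digit, and [c (U j) = U j.-1] shifts the weights. The last
    digit adds nothing, since a prefix shorter than [U 1] has no B. *)
Lemma prefix_B_digits p q k n : (q < p)%N -> (n < U p q k.+1)%N ->
  prefix_B p q n = (\sum_(1 <= j < k.+1) udigit (U p q) k n j * U p q j.-1)%N.
Proof.
move=> qp; have p0 : (0 < p)%N by lia.
elim: k n => [|k IHk] n n_lt.
  by move: n_lt; rewrite big_geq // -prefix_B_lt_U // ltnS leqn0 => /eqP.
have /andP[_ U_gt] := phi_iter_count q k.+1 p0.
have U0 : (0 < U p q k.+1)%N by lia.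
rewrite {1}(divn_eq n (U p q k.+1)) prefix_B_add_U -?divn_eq ?ltn_mod // prefix_B_US //.
rewrite big_nat_recr //= eqxx addnC; congr (_ + _)%N.
rewrite IHk ?ltn_mod //; apply: eq_big_nat => j /andP[_ j_lt].
by rewrite ltn_eqF // {1}[in RHS](divn_eq n (U p q k.+1)) addKn.
Qed.

(** * The words w^(k) and the factors richest in B *)

Lemma size_phi_compl p q w : (q <= p)%N ->
  (size (phi p q w) + (p - q) * count_mem B w = p.+1 * size w)%N.
Proof.
move=> qp; rewrite size_count_letter !count_phi (size_count_letter w).
by rewrite mulnBl mulnDr !mulSn; have := leq_mul qp (leqnn (count_mem B w)); lia.
Qed.

(** [L] depends only on length and B count, so the image of this prefix is complementary to
    phi(w^(k)) in phi^(k+2)(A). The extra one is the leading B of w^(k+1). *)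
Lemma image_len_w_seq p q k : (q < p)%N ->
  (prefix_B p q (U p q k.+1 - size (w_seq p q k)) + count_mem B (w_seq p q k)
    = U p q k)%N ->
  image_len p q (U p q k.+1 - size (w_seq p q k)) =
    (U p q k.+2 - size (w_seq p q k.+1)).+1.
Proof.
move=> qp cW; have p0 : (0 < p)%N by lia.
have W_lt := w_seq_lt_U q k p0; have W1_lt := w_seq_lt_U q k.+1 p0.
have szW : size (w_seq p q k.+1) = (size (phi p q (w_seq p q k))).+1 by [].
have := image_len_compl (U p q k.+1 - size (w_seq p q k)) (ltnW qp).
have := image_len_compl (U p q k.+1) (ltnW qp).
have := size_phi_compl (w_seq p q k) (ltnW qp).
have := leq_mul (leqnn p.+1) (ltnW W_lt).
rewrite -U_image_len // prefix_B_US // -cW mulnBr mulnDr.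
by move: W1_lt; rewrite szW; lia.
Qed.

Lemma prefix_B_w_seq p q k : (q < p)%N ->
  (prefix_B p q (U p q k.+1 - size (w_seq p q k)) + count_mem B (w_seq p q k)
    = U p q k)%N.
Proof.
move=> qp; have p0 : (0 < p)%N by lia.
elim: k => [|k /(image_len_w_seq qp) LW].
  rewrite U_image_len // image_lenE (prefix_B_small q (i := 1)) //.
  by rewrite prefix_B_small // /U /=; lia.
have W_lt := w_seq_lt_U q k p0.
have -> : count_mem B (w_seq p q k.+1) = (size (w_seq p q k)).+1.
  by rewrite /= count_phi -size_count_letter.
(* The prefix one letter longer is an image; its final B is the leading B of w^(k+1). *)
rewrite (@prefix_B_image_len_pred _ _ (U p q k.+1 - (size (w_seq p q k)).+1)) //.
  by lia.
by rewrite subnSK.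
Qed.

(* The word w^(k) is a suffix of phi^(k+1)(A), so that
   [U k - prefix_B (U k.+1 - n)] counts the B's in its suffix of length [n]. *)
Lemma factor_B_le p q k i n : (q < p)%N -> (n <= size (w_seq p q k))%N ->
  (prefix_B p q (i + n) + prefix_B p q (U p q k.+1 - n) <= prefix_B p q i + U p q k)%N.
Proof.
move=> qp; have p0 : (0 < p)%N by lia.
elim: k i n => [|k IHk] i n n_le.
  have U1 : U p q 1 = p.+1.
    by rewrite U_image_len // image_lenE prefix_B_small // /U /=; lia.
  move: n_le => /=; case: n => [|[|]] // _.
    by rewrite addn0 subn0 prefix_B_US.
  rewrite U1 subn1 (prefix_B_small q p0 (leqnn p)) addn1 prefix_BS /U /=.
  by case: (_ == _); lia.
have W_lt := w_seq_lt_U q k p0; have W1_lt := w_seq_lt_U q k.+1 p0.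
set x := prefix_B p q (U p q k.+2 - n).
have x_le : (x <= U p q k.+1)%N.
  by rewrite /x -[leqRHS]prefix_B_US // leq_prefix_B // leq_subr.
(* The induction hypothesis for [c], reversed because [c] enters [L] with coefficient [-(p - q)]. *)
have L_convex a e : (e <= size (w_seq p q k))%N ->
    (image_len p q a + U p q k.+2
       <= image_len p q (a + e) + image_len p q (U p q k.+1 - e))%N.
  move=> e_le; have := leq_mul (leqnn (p - q)) (IHk a e e_le).
  rewrite (U_image_len q k.+1) // !mulnDr.
  have := image_len_compl a (ltnW qp); have := image_len_compl (a + e) (ltnW qp).
  have := image_len_compl (U p q k.+1 - e) (ltnW qp).
  have := image_len_compl (U p q k.+1) (ltnW qp).
  have : (p.+1 * e <= p.+1 * U p q k.+1)%N by rewrite leq_mul2l; lia.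
  rewrite prefix_B_US // mulnBr mulnDr; lia.
(* The Galois form of the goal, split using [i < L (c i).+1]. Here [U k.+1 - x] counts the B's in
   the suffix of length [n]. *)
suff : (i + n < image_len p q (prefix_B p q i).+1 + n
          <= image_len p q (prefix_B p q i + (U p q k.+1 - x)).+1)%N.
  case/andP=> lt1 /(leq_trans lt1); rewrite ltnNge -prefix_B_galois // -ltnNge; lia.
rewrite ltn_add2r ltnNge -prefix_B_galois // ltnn /= -addSn.
have [D_le|D_gt] := leqP (U p q k.+1 - x)%N (size (w_seq p q k)).
  have := L_convex (prefix_B p q i).+1 _ D_le; rewrite subKn //.
  have : (image_len p q x <= U p q k.+2 - n)%N by rewrite -prefix_B_galois.
  by lia.
(* Beyond the range of the induction hypothesis, stop at the length of w^(k). This yields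
   [|w^(k+1)| - 1], and strict monotonicity of [L] supplies the missing one. *)
have /(ltn_image_len q p0) : ((prefix_B p q i).+1 + size (w_seq p q k) <
   (prefix_B p q i).+1 + (U p q k.+1 - x))%N by rewrite ltn_add2l.
have := L_convex (prefix_B p q i).+1 _ (leqnn _).
rewrite (image_len_w_seq qp (prefix_B_w_seq k qp)).
by lia.
Qed.

(** * From B counts to Abelian complexity *)

Lemma exists_intermediate (f : nat -> nat) M v :
  (forall i, f i.+1 <= (f i).+1)%N -> (f 0%N <= v <= f M)%N -> exists i, f i = v.
Proof.
move=> fS /andP[f0 fM]; have ex : exists i, (v <= f i)%N by exists M.
case: (ex_minnP ex) => -[|i] v_le min_i.
  by exists 0%N; apply/eqP; rewrite eqn_leq f0.
exists i.+1; apply/eqP; rewrite eqn_leq v_le andbT (leq_trans (fS i)) // ltnNge.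
by apply: contraPN (ltnn i) => /min_i ->.
Qed.

(** At fixed length the B count determines the Parikh vector, so it suffices to count an interval of
    integers. *)
Lemma abelian_complexity_interval u n i j :
  (forall l, count_mem B (block u i n) <= count_mem B (block u l n)
               <= count_mem B (block u j n))%N ->
  (forall v, count_mem B (block u i n) <= v <= count_mem B (block u j n) ->
     exists l, count_mem B (block u l n) = v)%N ->
  abelian_complexity u n =
    (count_mem B (block u j n) - count_mem B (block u i n)).+1.
Proof.
set m := count_mem B (block u i n); set M := count_mem B (block u j n).
move=> ex_ge ex_v; rewrite /abelian_complexity.
pose s := [seq ((n - v)%N, v) | v <- iota m (M - m).+1].
have count_A l : count_mem A (block u l n) = (n - count_mem B (block u l n))%N.
  by have := size_count_letter (block u l n); rewrite size_mkseq; lia.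
have le_mM : (m <= M)%N by case/andP: (ex_ge i).
have -> : [set parikh w | w in factors u n]%classic = [set` [fset x in s]%fset]%classic.
  apply/seteqP; split=> [_ [_ [l ->] <-]|x] /=; rewrite in_fset.
    rewrite /parikh count_A; apply: (map_f (fun v => ((n - v)%N, v))).
    by rewrite mem_iota; have := ex_ge l; lia.
  move=> /mapP[v]; rewrite mem_iota => v_in ->.
  have [|l lv] := ex_v v; first by lia.
  by exists (block u l n); [exists l | rewrite /parikh count_A lv].
rewrite set_fsetK card_fseq undup_id ?size_map ?size_iota //.
by rewrite map_inj_uniq ?iota_uniq // => v w [].
Qed.

Theorem theorem5p5 (p q : nat) (hq : (1 <= q)%N) (hqp : (q < p)%N)
    (n : nat) (hn : (0 < n)%N) (k : nat) (hk : (n <= size (w_seq p q k))%N) :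
  let d := udigit (U p q) k n in
  let e := udigit (U p q) k (U p q k.+1 - n)%N in
  (abelian_complexity (u_beta p q) n)%:Z =
    1 + (U p q k)%:Z
      - \sum_(1 <= j < k.+1) ((d j)%:Z + (e j)%:Z) * (U p q j.-1)%:Z.
Proof.
move=> d e; have p0 : (0 < p)%N by lia.
have n_lt := leq_ltn_trans hk (w_seq_lt_U q k p0).
have Un_lt : (U p q k.+1 - n < U p q k.+1)%N by rewrite ltn_subrL hn (leq_trans _ n_lt).
have cE i := count_B_block p q i n.
have c0 : count_mem B (block (u_beta p q) 0 n) = prefix_B p q n by [].
(* This window is the suffix of length [n] of phi^(k+1)(A), which has [U k] B's in all. *)
have cM := cE (U p q k.+1 - n)%N; rewrite subnK ?prefix_B_US ?(ltnW n_lt) // in cM.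
have cl l : (count_mem B (block (u_beta p q) 0 n) <= count_mem B (block (u_beta p q) l n)
    <= count_mem B (block (u_beta p q) (U p q k.+1 - n) n))%N.
  have := prefix_B_superadd l n hqp; have := factor_B_le l hqp hk.
  by rewrite -cE c0; lia.
rewrite (abelian_complexity_interval cl); last first.
  move=> v; apply: exists_intermediate => i.
  have := cE i; have := cE i.+1; rewrite addSn !prefix_BS.
  by case: (_ == _); case: (_ == _); lia.
(* Minimum at most maximum: the truncated subtraction is exact in the integers. *)
have := cl 0%N; rewrite c0.
under eq_bigr do rewrite mulrDl -!PoszM.
rewrite big_split /= -!(big_morph Posz PoszD (erefl _)).
rewrite -!prefix_B_digits //; move: cM.
by move: (count_mem B _) (prefix_B p q n) (prefix_B _ _ _); lia.
Qed.
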